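(* Let $P$ be a non-abelian finite $p$-group, $p$ a prime. Then $P$ is a $\mathbf{GC}^*$-group if and only if $\mathbf{Z}(P)$ is cyclic and $|P'| = p$.
   Context: Galois automorphisms act on characters by $\chi^\alpha(g)=\chi(g)^\alpha$; two irreducible characters of $G$ are Galois conjugate if one is the image of the other under some element of $\mathrm{Gal}(\mathbb{Q}_n|\mathbb{Q})$ with $|G|$ dividing $n$. A finite group is a $\mathbf{GC}^*$-group if any two of its non-linear irreducible characters of the same degree are Galois conjugate. *)

(* Defs.v *)
From mathcomp Require Import all_boot all_order all_algebra all_fingroup all_solvable all_field all_character.
Set Implicit Arguments. Unset Strict Implicit. Unset Printing Implicit Defensive.
Import GRing.Theory Num.Theory.
Local Open Scope ring_scope.

(* Two irreducible characters of G are Galois conjugate if one is the image of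
   the other under a field automorphism of algC (acting on values, cfAut). Since
   character values of G lie in Q_|G| and every automorphism of Q_n extends to
   algC (and every automorphism of algC restricts to Q_n), this is the paper's
   notion. *)
Definition galois_conjugate (gT : finGroupType) (G : {group gT}) (i j : Iirr G) :=
  exists u : {rmorphism algC -> algC}, cfAut u 'chi[G]_i = 'chi[G]_j.

Definition GCstar (gT : finGroupType) (G : {group gT}) :=
  forall i j : Iirr G,
    'chi[G]_i \notin linear_char -> 'chi[G]_j \notin linear_char ->
    'chi[G]_i 1%g = 'chi[G]_j 1%g -> galois_conjugate i j.

(* Main.v *)
Require Import Defs.
From mathcomp Require Import all_boot all_order all_algebra all_fingroup all_solvable all_field all_character.

(** If [Z(P)] is cyclic and [|P'| = p], then every nonlinear irreducible
    character is faithful, vanishes off [Z(P)], and restricts to [Z(P)] as a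
    multiple of a faithful linear character of a cyclic group; any two
    characters of the latter kind are Galois conjugate.

    Conversely, Galois conjugate characters have the same kernel. If [M] is
    normal in a GC*-group [P] and [|P' : M| = p], the nonlinear irreducible
    characters of [P / M] all have degree [|P : Z(chi)|^(1/2)], with [Z(chi)]
    depending only on [M], hence a common kernel, which twisting by linear
    characters forces to be [M]. For [M = 1] this makes [Z(P)] cyclic. If
    [|P'| > p], pass to a quotient with [|P'| = p^2] and take such a [chi]
    with kernel [N] of order [p]; then [|Z(chi) : Z(P)|] divides [p]. If [P']
    is central, another nonlinear character with kernel different from [N] also
    has this property, and comparing parities of exponents of [p] in
    [|P : Z(P)|] shows that the two degrees agree, a contradiction. Otherwise
    [Z(P) = N] and [Z(chi) = P'], the centralizer [C] of [P'] has index [p] and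
    [C' <= N] by the three subgroups lemma, which gives [chi(1) <= p], then
    [|C : P'| <= p] and [C] abelian; so all nonlinear characters have degree
    [p], again a contradiction. *)

Set Implicit Arguments. Unset Strict Implicit. Unset Printing Implicit Defensive.
Import GroupScope GRing.Theory Num.Theory.
Local Open Scope ring_scope.

(** * Galois conjugacy, centres of characters and degree bounds *)

Lemma galois_conjugate_cfker (gT : finGroupType) (G : {group gT}) (i j : Iirr G) :
  galois_conjugate i j -> cfker 'chi_i = cfker 'chi_j.
Proof. by case=> u <-; rewrite cfker_aut. Qed.

Lemma GCstar_quotient (gT : finGroupType) (G M : {group gT}) :
  (M <| G)%g -> GCstar G -> GCstar (G / M)%G.
Proof.
move=> nsMG gcG i j nli nlj eq_ij1.
have [u] : galois_conjugate (mod_Iirr i) (mod_Iirr j).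
  by apply: gcG; rewrite !mod_IirrE ?cfMod_lin_charE ?cfMod1.
rewrite !mod_IirrE // cfAutMod => /(can_inj (cfModK nsMG)) def_j.
by exists u.
Qed.

Lemma irr_cfcenter_commg (gT : finGroupType) (G : {group gT}) (i : Iirr G) x :
  x \in G ->
  (x \in 'Z('chi_i)%CF) = ([~: [set x], G] \subset cfker 'chi_i)%g.
Proof.
move=> Gx; have nKG := normal_norm (cfker_normal 'chi_i).
have nKx : [set x] \subset 'N(cfker 'chi_i) by rewrite sub1set (subsetP nKG).
rewrite -quotient_cents2 // -sub1set.
rewrite -(quotientSGK nKx (normal_sub (cfker_center_normal _))).
by rewrite cfcenter_eq_center subsetI quotientS ?sub1set.
Qed.

(** As [H'] acts trivially, the restriction to [H] has a linear constituent, and ['chi_i] is a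
    constituent of the character induced from it, of degree [|G : H|]. *)
Lemma irr1_le_index (gT : finGroupType) (G H : {group gT}) (i : Iirr G) :
    H \subset G -> (H^`(1) \subset cfker 'chi_i)%g ->
  'chi_i 1%g <= #|G : H|%g%:R.
Proof.
move=> sHG kerH'; have [j jP] := constt_cfRes_irr H i.
have lin_j : 'chi_j \is a linear_char.
  rewrite lin_irr_der1; apply: subset_trans (cfker_constt _ jP).
    by rewrite cfker_Res ?irr_char // subsetI der_sub.
  by rewrite cfRes_char ?irr_char.
rewrite -constt_Ind_Res in jP.
have := char1_ge_constt (cfInd_char G (irr_char j)) jP.
by rewrite cfInd1 // (lin_char1 lin_j) mulr1.
Qed.

Lemma prime_normal_sub_center (gT : finGroupType) (G N : {group gT}) (p : nat) :
  prime p -> (p.-group G)%g -> (N <| G)%g -> #|N| = p -> (N \subset 'Z(G))%g.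
Proof.
move=> p_pr pG nsNG oN; apply: prime_meetG; first by rewrite oN.
apply: meet_center_nil (pgroup_nil pG) nsNG _.
by rewrite -cardG_gt1 oN prime_gt1.
Qed.

(** * Characters over a normal subgroup of index [p] in the derived subgroup *)

Section DerivedIndexPrime.

Variables (gT : finGroupType) (G M : {group gT}) (p : nat).
Hypotheses (p_pr : prime p) (pG : (p.-group G)%g).
Hypotheses (nsMG : (M <| G)%g) (sMG' : M \subset (G^`(1))%g).
Hypothesis iMG' : #|(G^`(1))%g : M|%g = p.

Lemma cfkerI_der1 (i : Iirr G) :
    'chi_i \notin linear_char -> M \subset cfker 'chi_i ->
  (cfker 'chi_i :&: G^`(1))%g = M.
Proof.
rewrite lin_irr_der1 => nker kerM; apply/eqP; rewrite eq_sym eqEsubset.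
rewrite subsetI kerM sMG' /=.
have sKG' : (cfker 'chi_i :&: G^`(1) \subset G^`(1))%g by apply: subsetIr.
have sMK : M \subset (cfker 'chi_i :&: G^`(1))%g by rewrite subsetI kerM.
have: (#|cfker 'chi_i :&: G^`(1) : M| %| p)%N%g.
  by rewrite -iMG' -(Lagrange_index sKG' sMK) dvdn_mull.
case/primeP: p_pr => _ dvdp /dvdp/orP[] /eqP iK.
  by rewrite -indexg_eq1 iK.
case/negP: nker; apply/setIidPr/eqP.
by rewrite eqEcard sKG' -(Lagrange sMG') -(Lagrange sMK) iK iMG' leqnn.
Qed.

Lemma commg_der1_sub : ([~: G^`(1), G] \subset M)%g.
Proof.
have nMG := normal_norm nsMG; have nMG' := subset_trans (der_sub 1 G) nMG.
rewrite -quotient_cents2 //.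
have nsQ : (G^`(1) / M <| G / M)%g by rewrite quotient_normal ?der_normal.
have := prime_normal_sub_center p_pr (quotient_pgroup M pG) nsQ.
by rewrite card_quotient // subsetI => /(_ iMG')/andP[].
Qed.

(** The right-hand side does not mention [i]: all nonlinear characters over [M] share one centre,
    hence one degree. *)
Lemma mem_cfcenter_der1 (i : Iirr G) x :
    'chi_i \notin linear_char -> M \subset cfker 'chi_i -> x \in G ->
  (x \in 'Z('chi_i)%CF) = ([~: [set x], G] \subset M)%g.
Proof.
move=> nl kerM Gx; rewrite irr_cfcenter_commg // -(cfkerI_der1 nl kerM).
by rewrite subsetI [X in _ && X]commSg ?sub1set ?andbT.
Qed.

Lemma der1_sub_cfcenter (i : Iirr G) :
    'chi_i \notin linear_char -> M \subset cfker 'chi_i ->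
  (G^`(1) \subset 'Z('chi_i)%CF)%g.
Proof.
move=> nl kerM; apply/subsetP=> x G'x.
rewrite mem_cfcenter_der1 ?(subsetP (der_sub 1 G)) //.
by apply: subset_trans commg_der1_sub; rewrite commSg ?sub1set.
Qed.

Lemma irr1_sqr_der1 (i : Iirr G) :
    'chi_i \notin linear_char -> M \subset cfker 'chi_i ->
  'chi_i 1%g ^+ 2 = #|G : 'Z('chi_i)%CF|%g%:R.
Proof.
by move=> nl kerM; apply/irr1_abelian_bound/sub_der1_abelian/der1_sub_cfcenter.
Qed.

Lemma GCstar_eq_cfker (i j : Iirr G) : GCstar G ->
    'chi_i \notin linear_char -> M \subset cfker 'chi_i ->
    'chi_j \notin linear_char -> M \subset cfker 'chi_j ->
  cfker 'chi_i = cfker 'chi_j.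
Proof.
move=> gcG nli kerMi nlj kerMj; apply/galois_conjugate_cfker/gcG => //.
have eqZ : 'Z('chi_i)%CF = 'Z('chi_j)%CF.
  apply/setP=> x; have [Gx | notGx] := boolP (x \in G).
    by rewrite !mem_cfcenter_der1.
  by rewrite !(contraNF (subsetP (cfcenter_sub _) x)).
apply/eqP; rewrite -(eqrXn2 (n := 2)) ?char1_ge0 ?irr_char //.
by rewrite !irr1_sqr_der1 // eqZ.
Qed.

(* Twisting a nonlinear character by all linear ones does not change its
   kernel, so this kernel lies in the kernel of every irreducible character
   of [G / M]. *)
Lemma GCstar_cfker (i : Iirr G) : GCstar G ->
    'chi_i \notin linear_char -> M \subset cfker 'chi_i ->
  cfker 'chi_i = M.
Proof.
move=> gcG nli kerMi; apply/eqP; rewrite eqEsubset kerMi andbT.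
rewrite -(cap_cfker_normal nsMG); apply/bigcapsP=> j kerMj.
have [lin_j | nlj] := boolP ('chi_j \is a linear_char); last first.
  by rewrite (GCstar_eq_cfker gcG nli kerMi nlj kerMj).
have /irrP[k def_k] := mul_lin_irr lin_j (mem_irr i).
have k1 : 'chi_k 1%g = 'chi_i 1%g by rewrite -def_k cfunE (lin_char1 lin_j) mul1r.
have nlk : 'chi_k \notin linear_char.
  by rewrite qualifE /= irr_char k1; move: nli; rewrite qualifE /= irr_char.
have kerMk : M \subset cfker 'chi_k.
  rewrite -def_k; apply: subset_trans (cfker_mul _ _).
  by rewrite subsetI kerMj.
apply/subsetP=> x Kx; have Gx := subsetP (cfker_sub _) x Kx.
have Kkx : x \in cfker 'chi_k by rewrite -(GCstar_eq_cfker gcG nli kerMi).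
rewrite cfkerEirr inE; apply/eqP; apply: (mulIf (irr1_neq0 i)).
by rewrite -{1}(cfker1 Kx) (lin_char1 lin_j) mul1r -k1 -(cfker1 Kkx) -def_k cfunE.
Qed.

(** Otherwise [G'] would lie in every kernel containing [M], hence in their intersection [M]. *)
Lemma nonlinear_irr_der1 :
  exists2 i : Iirr G, 'chi_i \notin linear_char & M \subset cfker 'chi_i.
Proof.
have [/exists_inP[i nl kerM] | /exists_inPn nex] :=
  boolP [exists (i : Iirr G | 'chi_i \notin linear_char), M \subset cfker 'chi_i].
  by exists i.
have /negP[] : ~~ (G^`(1) \subset M)%g.
  by rewrite -indexg_eq1 iMG'; case: (p) p_pr => [|[]].
rewrite -(cap_cfker_normal nsMG); apply/bigcapsP=> i kerM.
rewrite -lin_irr_der1; apply: contraLR kerM; exact: nex.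
Qed.

End DerivedIndexPrime.

(** * The index of [Z(G)] in the centre of a character *)

Lemma center_sub_cfcenter (gT : finGroupType) (G : {group gT}) (i : Iirr G) :
  ('Z(G) \subset 'Z('chi_i)%CF)%g.
Proof. by rewrite -cap_cfcenter_irr (bigcap_inf i). Qed.

(** [Z(chi) / Z(G)] is a quotient of the cyclic group [Z(chi) / K]. Its exponent divides [p]: for
    [x] in [Z(chi)], [[x, y]] lies in the central subgroup [K] of order [p], so [[x ^ p, y] = [x, y]
    ^ p = 1]. *)
Lemma cfcenter_index_dvd (gT : finGroupType) (G : {group gT}) (p : nat)
    (i : Iirr G) :
    prime p -> (p.-group G)%g -> #|cfker 'chi_i| = p ->
  (#|'Z('chi_i)%CF : 'Z(G)|%g %| p)%N.
Proof.
move=> p_pr pG oK; set Z := 'Z('chi_i)%CF; set K := cfker 'chi_i.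
have sKZG : (K \subset 'Z(G))%g.
  exact: prime_normal_sub_center p_pr pG (cfker_normal _) oK.
have sZG : Z \subset G := cfcenter_sub _.
have nsKZ : (K <| Z)%g := cfker_center_normal _.
have nsZGZ : ('Z(G) <| Z)%g.
  exact: normalS (center_sub_cfcenter i) sZG (center_normal G).
have cycZ : cyclic (Z / 'Z(G))%g.
  by rewrite -(isog_cyclic (third_isog sKZG nsKZ nsZGZ)) quotient_cyclic ?cfcenter_cyclic.
rewrite -card_quotient ?normal_norm // -(exponent_cyclic cycZ).
apply/exponentP=> _ /morphimP[x nx Zx ->]; rewrite -morphX //=.
have Gx := subsetP sZG x Zx; apply/coset_id/centerP; split=> [|y Gy].
  exact: groupX.
have : [~ x, y]%g \in K.
  have := Zx; rewrite irr_cfcenter_commg // => /subsetP; apply.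
  by rewrite mem_commg ?set11.
move=> Kxy; apply/commgP; rewrite commXg; last first.
  by have /centerP[_ /(_ x Gx)/esym] := subsetP sKZG _ Kxy.
by rewrite -oK expg_cardG.
Qed.

(** Both [s] and [t] are [1] or [p]; if they differed, the exponents of [p] on the two sides would
    have different parities. *)
Lemma sqr_mul_dvd_prime_inj (p a b s t : nat) :
    prime p -> (0 < a)%N -> (0 < b)%N -> (s %| p)%N -> (t %| p)%N ->
  (a ^ 2 * s = b ^ 2 * t)%N -> a = b.
Proof.
move=> p_pr a0 b0; case/primeP: (p_pr) => _ dvdp.
have odd_sqr n m : (0 < n)%N -> (0 < m)%N -> (n ^ 2 * 1)%N <> (m ^ 2 * p)%N.
  move=> n0 m0 /(congr1 (logn p)).
  rewrite -!mulnn muln1 !lognM ?muln_gt0 ?n0 ?m0 ?prime_gt0 //.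
  by move/(congr1 odd); rewrite !oddD !addbb logn_prime // eqxx.
case/dvdp/orP=> /eqP-> /dvdp/orP[] /eqP->.
- by rewrite !muln1 => /eqP; rewrite eqn_sqr => /eqP.
- by move/odd_sqr; case.
- by move/esym/odd_sqr; case.
- by move/eqP; rewrite eqn_pmul2r ?prime_gt0 // eqn_sqr => /eqP.
Qed.

(** * No GC*-group of order a power of [p] has a derived subgroup of order [p ^ 2] *)

Section DerivedOrderPrimeSquare.

Variables (gT : finGroupType) (P : {group gT}) (p : nat).
Hypotheses (p_pr : prime p) (pP : (p.-group P)%g).
Hypothesis oP' : #|(P^`(1))%g| = (p ^ 2)%N.

Let p_gt0 : (0 < p)%N := prime_gt0 p_pr.

Lemma der1_index_prime (N : {group gT}) :
  N \subset (P^`(1))%g -> #|N| = p -> #|(P^`(1))%g : N|%g = p.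
Proof.
move=> sNP' oN; apply/eqP; rewrite -(eqn_pmul2l p_gt0) -{1}oN Lagrange //.
by rewrite oP' mulnn.
Qed.

Lemma der1_normal_prime :
  exists N : {group gT}, [/\ N \subset (P^`(1))%g, (N <| P)%g & #|N| = p].
Proof.
have [|N [sNP' nsN oN]] := normal_pgroup (r := 1) pP (der_normal 1 P).
  by rewrite oP' pfactorK.
by exists N; split; rewrite // oN expn1.
Qed.

Lemma ex_irr_not_sub_cfker (N : {group gT}) : #|N| = p ->
  exists i : Iirr P, ~~ (N \subset cfker 'chi_i).
Proof.
move=> oN; apply/existsP; rewrite -negb_forall; apply/negP=> /forallP kerN.
have: N \subset [1 gT]%g by rewrite -(TI_cfker_irr P); apply/bigcapsP.
by move/subset_leq_card; rewrite oN cards1 leqNgt prime_gt1.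
Qed.

Lemma ex_nonlinear_irr_cfker (N : {group gT}) : GCstar P ->
    N \subset (P^`(1))%g -> (N <| P)%g -> #|N| = p ->
  exists i : Iirr P, exists2 d : nat,
    [/\ 'chi_i \notin linear_char, cfker 'chi_i = N & 'chi_i 1%g = d%:R]
    & (0 < d)%N /\ (d ^ 2)%N = #|P : 'Z('chi_i)%CF|%g.
Proof.
move=> gcP sNP' nsNP oN; have iN := der1_index_prime sNP' oN.
have [i nl kerN] := nonlinear_irr_der1 p_pr nsNP iN.
exists i, (irr_degree (socle_of_Iirr i)); last first.
  split; first exact: irr_degree_gt0.
  by apply/eqP; rewrite -eqC_nat natrX -irr1_degree (irr1_sqr_der1 p_pr pP nsNP).
by split; [|exact: (GCstar_cfker p_pr pP nsNP) | exact: irr1_degree].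
Qed.

Lemma GCstar_der1_not_central : GCstar P -> ~~ (P^`(1) \subset 'Z(P))%g.
Proof.
move=> gcP; apply/negP=> sP'Z.
have [N [sNP' nsNP oN]] := der1_normal_prime.
have [i [d [nli kerNi di] [d0 sqr_d]]] := ex_nonlinear_irr_cfker gcP sNP' nsNP oN.
have sZi : (#|'Z('chi_i)%CF : 'Z(P)|%g %| p)%N.
  by apply: cfcenter_index_dvd => //; rewrite kerNi.
have eqPZ (j : Iirr P) :
    (#|P : 'Z('chi_j)%CF| * #|'Z('chi_j)%CF : 'Z(P)|)%N%g = #|P : 'Z(P)|%g.
  by rewrite Lagrange_index ?cfcenter_sub ?center_sub_cfcenter.
(* Both degrees squared, times a divisor of [p], equal [|P : Z(P)|], so they coincide although the
   kernels differ. *)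
suff [j [e [nlj dj e0] [sqr_e sZj nkerNj]]] : exists j : Iirr P, exists2 e : nat,
    [/\ 'chi_j \notin linear_char, 'chi_j 1%g = e%:R & (0 < e)%N]
    & [/\ (e ^ 2)%N = #|P : 'Z('chi_j)%CF|%g,
         (#|'Z('chi_j)%CF : 'Z(P)|%g %| p)%N & cfker 'chi_j != N].
  have eq_de : d = e.
    by apply: sqr_mul_dvd_prime_inj p_pr d0 e0 sZi sZj _; rewrite sqr_d sqr_e !eqPZ.
  case/eqP: nkerNj; rewrite -kerNi; apply/esym/galois_conjugate_cfker/gcP => //.
  by rewrite di dj eq_de.
have [j nkerNj] := ex_irr_not_sub_cfker oN.
have nlj : 'chi_j \notin linear_char.
  by rewrite lin_irr_der1; apply: contra nkerNj; apply: subset_trans.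
pose K := (cfker 'chi_j :&: P^`(1))%G.
have nsKP : (K <| P)%g by rewrite normalI ?cfker_normal ?der_normal.
have sKP' : K \subset (P^`(1))%g := subsetIr _ _.
(* If [K = 1], then [[Z(chi_j), P] <= K] is trivial and [chi_j] itself serves. If not, [|K| = p],
   and a nonlinear character with kernel [K] serves. *)
have [K1 | ntK] := eqVneq (K : {set gT}) 1%g.
  have Zj : 'Z('chi_j)%CF = 'Z(P)%g.
    apply/eqP; rewrite eqEsubset center_sub_cfcenter andbT subsetI cfcenter_sub.
    rewrite (sameP commG1P trivgP) -K1 subsetI commSg ?cfcenter_sub // andbT.
    have nKP := normal_norm (cfker_normal 'chi_j).
    rewrite -quotient_cents2 ?(subset_trans (cfcenter_sub _)) //.
    by rewrite cfcenter_eq_center subsetIr.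
  exists j, (irr_degree (socle_of_Iirr j)).
    by split; rewrite ?irr1_degree ?irr_degree_gt0.
  split.
  - apply/eqP; rewrite -eqC_nat natrX -irr1_degree irr1_abelian_bound //.
    by rewrite sub_der1_abelian //= Zj.
  - by rewrite Zj indexgg dvd1n.
  - by apply: contraNneq nkerNj => ->.
have oK : #|K| = p.
  have [k le_k2 oK] : exists2 k, (k <= 2)%N & #|K| = (p ^ k)%N.
    by apply/(dvdn_pfactor _ _ p_pr); rewrite -oP' cardSg.
  case: k => [|[|[]]] // in le_k2 oK *.
    by rewrite -cardG_gt1 oK in ntK.
  case/negP: nlj; rewrite lin_irr_der1; apply/setIidPr/eqP.
  by rewrite eqEcard sKP' oP' oK leqnn.
have [k [e [nlk kerKk dk] [e0 sqr_e]]] := ex_nonlinear_irr_cfker gcP sKP' nsKP oK.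
exists k, e => //; split=> //; first by apply: cfcenter_index_dvd => //; rewrite kerKk.
rewrite kerKk; apply: contraNneq nkerNj => <-; exact: subsetIl.
Qed.

(** For [z] in [P'] outside the central subgroup [N], centralizing [z] amounts to centralizing [P'].
    The class of [z] lies in the coset [z N], so the index is at most [p]. *)
Lemma index_cent_der1 : ~~ (P^`(1) \subset 'Z(P))%g ->
  #|P : 'C_P(P^`(1))|%g = p.
Proof.
move=> nsP'Z; have [N [sNP' nsNP oN]] := der1_normal_prime.
have iN := der1_index_prime sNP' oN.
have sNZ := prime_normal_sub_center p_pr pP nsNP oN.
have /subsetPn[z P'z nNz] : ~~ (P^`(1) \subset N)%g.
  by apply: contra nsP'Z => /subset_trans; apply.
have sP'P := der_sub 1 P; have Pz := subsetP sP'P z P'z.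
have sCzC : ('C_P[z] \subset 'C_P(P^`(1)))%g.
  apply/subsetP=> y /setIP[Py cyz]; rewrite inE Py /= -sub1set centsC.
  have sNC : N \subset ('C_(P^`(1))[y])%g.
    rewrite subsetI sNP' -cent_set1 centsC sub1set.
    by have /subsetIP[_] := sNZ; rewrite centsC => /subsetP; apply.
  have sCP' : ('C_(P^`(1))[y] \subset P^`(1))%g := subsetIl _ _.
  rewrite cent_set1; apply/setIidPl/eqP; rewrite eqEcard sCP' /=.
  rewrite -(Lagrange sNP') -(Lagrange sNC) leq_pmul2l ?cardG_gt0 // iN.
  have: (#|'C_(P^`(1))[y] : N| %| p)%N%g.
    by rewrite -iN -(Lagrange_index sCP' sNC) dvdn_mull.
  case/primeP: (p_pr) => _ dvdp /dvdp/orP[] /eqP iC; last by rewrite iC.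
  case/negP: nNz; apply: (subsetP (_ : 'C_(P^`(1))[y] \subset N)%g).
    by rewrite -indexg_eq1 iC.
  by rewrite inE P'z cent1C.
have le_p : (#|P : 'C_P(P^`(1))|%g <= p)%N.
  rewrite (leq_trans (dvdn_leq _ (indexgS P sCzC))) //= index_cent1 -oN -(card_lcoset N z).
  apply/subset_leq_card/subsetP=> _ /imsetP[y Py ->].
  rewrite mem_lcoset -/(commg z y).
  apply: (subsetP (commg_der1_sub p_pr pP nsNP iN)); exact: mem_commg.
have pC : (p.-nat #|P : 'C_P(P^`(1))|)%g.
  by apply: pnat_dvd pP; rewrite dvdn_indexg.
have [k iC] := p_natP pC; move: le_p; rewrite iC.
rewrite -{2}[p]expn1 leq_exp2l ?prime_gt1 //.
case: k iC => [|[]] // /eqP; rewrite indexg_eq1 => sPC _.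
case/negP: nsP'Z; rewrite subsetI sP'P centsC.
by case/subsetIP: sPC.
Qed.

Lemma nonlinear_irr1_abelian_index (A : {group gT}) (i : Iirr P) :
    A \subset P -> abelian A -> #|P : A|%g = p ->
  'chi_i \notin linear_char -> 'chi_i 1%g = p%:R.
Proof.
move=> sAP abA iA nl.
have := irr1_le_index (i := i) sAP; rewrite iA (derG1P abA) sub1G => /(_ isT).
have: ('chi_i 1%g %| #|P|%:R)%C := dvd_irr1_cardG i.
have: 'chi_i 1%g != 1.
  by apply: contra nl => d1; rewrite qualifE /= irr_char.
rewrite irr1_degree pnatr_eq1 ler_nat dvdC_nat => d1 dvd_d le_dp.
have /p_natP[k def_d] : (p.-nat (irr_degree (socle_of_Iirr i)))%N.
  exact: pnat_dvd dvd_d pP.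
move: d1 le_dp; rewrite def_d -{3}[p]expn1 leq_exp2l ?prime_gt1 //.
by case: k {def_d} => [|[]].
Qed.

Lemma GCstar_der1_central : GCstar P -> (P^`(1) \subset 'Z(P))%g.
Proof.
move=> gcP; have [// | nsP'Z] := boolP (P^`(1) \subset 'Z(P))%g.
have [N [sNP' nsNP oN]] := der1_normal_prime.
have iN := der1_index_prime sNP' oN.
have sNZ := prime_normal_sub_center p_pr pP nsNP oN.
have [i [d [nli kerNi di] [d0 sqr_d]]] := ex_nonlinear_irr_cfker gcP sNP' nsNP oN.
have sP'P := der_sub 1 P.
have sP'Zi : (P^`(1) \subset 'Z('chi_i)%CF)%g.
  by apply: (der1_sub_cfcenter p_pr pP nsNP sNP' iN nli); rewrite kerNi.
have nNP := normal_norm nsNP.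
have nNP' := subset_trans sP'P nNP.
have nNZ := subset_trans (center_sub P) nNP.
(* In the cyclic group [Z(chi_i) / N], the subgroup [P' / N] of order [p] is not inside [Z(P) / N],
   so [p] does not divide the order of the [p]-group [Z(P) / N]. *)
have defZ : 'Z(P)%g = N.
  apply/eqP; rewrite eqEsubset sNZ andbT.
  have cycZ : cyclic ('Z('chi_i)%CF / N)%g by rewrite -kerNi cfcenter_cyclic.
  have := cardSg_cyclic cycZ (quotientS N sP'Zi)
            (quotientS N (center_sub_cfcenter i)).
  rewrite quotientSGK // (negPf nsP'Z) card_quotient // iN => /negbT.
  rewrite -p'natE // => p'Z.
  have pZ : (p.-group ('Z(P) / N))%g.
    by rewrite quotient_pgroup ?(pgroupS (center_sub P)).
  rewrite -quotient_sub1 // subG1 trivg_card1.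
  by rewrite (pnat_1 pZ p'Z).
have defZi : 'Z('chi_i)%CF = (P^`(1))%g.
  apply/esym/eqP; rewrite eqEcard sP'Zi oP'.
  rewrite -(Lagrange (center_sub_cfcenter i)) /= defZ oN leq_pmul2l //=.
  by rewrite -defZ dvdn_leq // cfcenter_index_dvd // kerNi.
pose C := ('C_P(P^`(1)))%G.
have iC : #|P : C|%g = p := index_cent_der1 nsP'Z.
have sCP : C \subset P := subsetIl _ _.
have cCP' : (P^`(1) \subset 'C(C))%g by rewrite centsC subsetIr.
have sP'C : (P^`(1) \subset C)%g.
  rewrite subsetI sP'P; apply: p2group_abelian (pgroupS sP'P pP) _.
  by rewrite oP' pfactorK.
have sC'N : (C^`(1) \subset N)%g.
  rewrite -defZ subsetI (subset_trans (der_sub 1 C)) //=.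
  (* [[C, P]] and [[P, C]] lie in [P'], which [C] centralizes; hence [[[C, C], P] = 1]. *)
  rewrite (sameP commG1P eqP); apply/eqP/three_subgroup; apply/commG1P.
    by rewrite (subset_trans (commSg P sCP)).
  by rewrite (subset_trans (commgS P sCP)).
have le_dp : (d <= p)%N.
  by rewrite -(ler_nat algC) -di -iC irr1_le_index // kerNi.
(* [P'] is central in [C], and [p |C : P'| = d ^ 2 <= p ^ 2] makes [C / P'] cyclic. *)
have abC : abelian C.
  apply: (cyclic_factor_abelian (H := (P^`(1))%G)); first by rewrite subsetI sP'C.
  have nP'C := subset_trans sCP (der_norm 1 P).
  have : (#|C / P^`(1)|%g <= p)%N.
    rewrite card_quotient // -(leq_pmul2l p_gt0) -{1}iC Lagrange_index //=.
    by rewrite -defZi -sqr_d mulnn leq_sqr.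
  have /p_natP[k oQ] : (p.-group (C / P^`(1)))%g.
    by rewrite quotient_pgroup ?(pgroupS sCP).
  rewrite oQ -{2}[p]expn1 leq_exp2l ?prime_gt1 //.
  case: k oQ => [|[]] // oQ _; last by rewrite prime_cyclic // oQ expn1.
  by rewrite (card1_trivg oQ) cyclic1.
have [j nkerNj] := ex_irr_not_sub_cfker oN.
have nlj : 'chi_j \notin linear_char.
  by rewrite lin_irr_der1; apply: contra nkerNj; apply: subset_trans.
case/negP: nkerNj; rewrite -kerNi.
suff /galois_conjugate_cfker -> : galois_conjugate i j by [].
by apply: gcP; rewrite ?(nonlinear_irr1_abelian_index sCP abC iC).
Qed.

End DerivedOrderPrimeSquare.

(** * Necessity of the two conditions *)

Lemma GCstar_card_der1 (gT : finGroupType) (P : {group gT}) (p : nat) :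
    prime p -> (p.-group P)%g -> ~~ abelian P -> GCstar P ->
  #|(P^`(1))%g| = p.
Proof.
move=> p_pr pP nabP gcP; have nsP' := der_normal 1 P.
have /p_natP[k oP'] : (p.-group P^`(1))%g by rewrite (pgroupS (der_sub 1 P)).
case: k oP' => [/card1_trivg/derG1P abP | [-> | k oP']].
- by rewrite abP in nabP.
- exact: expn1.
(* Here [|P'| = p ^ (k + 2)]; an [M] of order [p ^ k] reduces to the case just excluded. *)
have [|M [sMP' nsMP oM]] := normal_pgroup (r := k) pP nsP'.
  by rewrite oP' pfactorK // (leq_trans (leqnSn k)).
have nMP := normal_norm nsMP.
have oQ' : #|((P / M)^`(1))%g| = (p ^ 2)%N.
  rewrite -quotient_der // card_quotient ?(subset_trans (der_sub 1 P)) //.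
  have oM0 : (0 < #|M|)%N := cardG_gt0 M.
  by apply/eqP; rewrite -(eqn_pmul2l oM0) Lagrange // oP' oM -expnD addn2.
have gcQ := GCstar_quotient nsMP gcP; have pQ := quotient_pgroup M pP.
have /negP[] := GCstar_der1_not_central p_pr pQ oQ' gcQ.
exact: GCstar_der1_central p_pr pQ oQ' gcQ.
Qed.

Lemma GCstar_cyclic_center (gT : finGroupType) (P : {group gT}) (p : nat) :
    prime p -> (p.-group P)%g -> #|(P^`(1))%g| = p -> GCstar P ->
  cyclic 'Z(P)%g.
Proof.
move=> p_pr pP oP' gcP; have sub1 := sub1G (P^`(1))%G.
have i1 : #|(P^`(1))%g : 1%G|%g = p by rewrite indexg1.
have [i nl ker1] := nonlinear_irr_der1 p_pr (normal1 P) i1.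
apply: (irr_faithful_center (i := i)).
by rewrite cfaithfulE (GCstar_cfker p_pr pP (normal1 P) sub1 i1 gcP nl ker1).
Qed.

(** * Sufficiency: faithful characters and their values on the centre *)

Lemma nonlinear_irr_faithful (gT : finGroupType) (P : {group gT}) (p : nat)
    (i : Iirr P) :
    prime p -> (p.-group P)%g -> cyclic 'Z(P)%g -> #|(P^`(1))%g| = p ->
  'chi_i \notin linear_char -> cfaithful 'chi_i.
Proof.
move=> p_pr pP cycZ oP'; apply: contraR => ntK; rewrite lin_irr_der1.
have sP'Z := prime_normal_sub_center p_pr pP (der_normal 1 P) oP'.
(* A nontrivial kernel meets the cyclic group [Z(P)] in a subgroup of order divisible by [p], which
   contains [P'], the only subgroup of order [p] there. *)
have ntKZ : (cfker 'chi_i :&: 'Z(P) != 1)%g.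
  rewrite meet_center_nil ?(pgroup_nil pP) ?cfker_normal //.
  by apply: contraNneq ntK => K1; rewrite cfaithfulE K1.
have sKZ := subsetIr (cfker 'chi_i) 'Z(P)%g.
have pKZ := pgroupS sKZ (pgroupS (center_sub P) pP).
have [_ dvdp _] := pgroup_pdiv pKZ ntKZ.
apply: subset_trans (subsetIl _ 'Z(P)%g).
by rewrite -(cardSg_cyclic cycZ) // oP'.
Qed.

Lemma faithful_linear_prim_root (gT : finGroupType) (H : {group gT})
    (xi : 'CF(H)) (z : gT) :
    xi \is a linear_char -> cfaithful xi -> z \in H ->
  (#[z]%g).-primitive_root (xi z).
Proof.
move=> lin_xi ffxi Hz.
have xi_z : xi z ^+ #[z]%g = 1 by rewrite -lin_charX // expg_order lin_char1.
have [m prim_m dvd_m] := prim_order_exists (order_gt0 z) xi_z.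
suff -> : #[z]%g = m by [].
apply/eqP; rewrite eqn_dvd dvd_m andbT order_dvdn -in_set1.
apply: (subsetP ffxi); rewrite cfkerEchar ?lin_charW // inE groupX //=.
by rewrite (lin_charX lin_xi) // (prim_expr_order prim_m) (lin_char1 lin_xi).
Qed.

Lemma faithful_irr_center_prim_root (gT : finGroupType) (G : {group gT})
    (i : Iirr G) (z : gT) :
    cfaithful 'chi_i -> z \in 'Z(G)%g ->
  exists2 w : algC, (#[z]%g).-primitive_root w
    & forall m, 'chi_i (z ^+ m)%g = 'chi_i 1%g * w ^+ m.
Proof.
move=> ffi; rewrite -(cfcenter_fful_irr ffi) => Zz.
have [xi lin_xi def_xi] := cfcenter_Res 'chi_i.
have chiE x : x \in 'Z('chi_i)%CF -> 'chi_i x = 'chi_i 1%g * xi x.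
  by move=> Zx; rewrite -(cfResE _ (cfcenter_sub _) Zx) def_xi cfunE.
exists (xi z) => [|m]; last by rewrite chiE ?groupX // lin_charX.
apply: faithful_linear_prim_root => //; apply: subset_trans ffi.
apply/subsetP=> x Kx; have Zx := subsetP (cfker_sub xi) x Kx.
by rewrite cfkerEirr inE chiE // (cfker1 Kx) (lin_char1 lin_xi) mulr1.
Qed.

Lemma cyclic_center_der1_GCstar (gT : finGroupType) (P : {group gT}) (p : nat) :
    prime p -> (p.-group P)%g -> cyclic 'Z(P)%g -> #|(P^`(1))%g| = p ->
  GCstar P.
Proof.
move=> p_pr pP cycZ oP' i j nli nlj eq_ij1.
have sP'Z := prime_normal_sub_center p_pr pP (der_normal 1 P) oP'.
have fful k := nonlinear_irr_faithful (i := k) p_pr pP cycZ oP'.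
have chi0 (k : Iirr P) x : 'chi_k \notin linear_char -> x \notin 'Z(P)%g -> 'chi_k x = 0.
  move=> nlk; have eqZ := cfcenter_fful_irr (fful k nlk).
  have abQ : abelian (P / 'Z('chi_k)%CF) by rewrite sub_der1_abelian //= eqZ.
  (* Equality in [chi(1) ^ 2 <= |P : Z(chi)|] forces [chi] to vanish off [Z(chi)]. *)
  have := irr1_bound k; rewrite (irr1_abelian_bound abQ) => -[_ /esym].
  rewrite eqxx => /cfun_onP; rewrite eqZ; apply.
have /cyclicP[z defZ] := cycZ.
have Zz : z \in 'Z(P)%g by rewrite defZ cycle_id.
have [w1 prim1 chi1] := faithful_irr_center_prim_root (fful i nli) Zz.
have [w2 prim2 chi2] := faithful_irr_center_prim_root (fful j nlj) Zz.
(* Both roots are primitive of order [#[z]], so [w2 = w1 ^+ k] with [k] coprime to [#[z]], and the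
   automorphism raising such roots to the power [k] carries one character to the other. *)
have [k def_w2] := prim_rootP prim1 (prim_expr_order prim2).
have co_k : coprime k #[z]%g by rewrite -(prim_root_exp_coprime _ prim1) -def_w2.
have [u uP] := Qn_aut_exists co_k; exists u; apply/cfunP=> x; rewrite cfunE /=.
have [Zx | notZx] := boolP (x \in 'Z(P)%g); last by rewrite !chi0 ?rmorph0.
have /cycleP[m ->] : x \in <[z]>%g by rewrite -defZ.
rewrite chi1 chi2 rmorphM rmorphXn /= (uP w1) ?(prim_expr_order prim1) // -def_w2.
by rewrite -eq_ij1 irr1_degree rmorph_nat.
Qed.

Theorem theorem3p1 (gT : finGroupType) (P : {group gT}) (p : nat) :
  prime p -> (p.-group P)%g -> ~~ abelian P ->
  (GCstar P <-> cyclic 'Z(P) /\ #|P^`(1)%g| = p).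
Proof.
move=> p_pr pP nabP; split=> [gcP | [cycZ oP']].
  have oP' := GCstar_card_der1 p_pr pP nabP gcP.
  by split; [exact: GCstar_cyclic_center p_pr pP oP' gcP |].
exact: cyclic_center_der1_GCstar cycZ oP'.
Qed.
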